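(* There exists a connected paving matroid $M$ such that $\mu(M)=3$ and $\eta(M)=2$. In particular, $\eta(M)<\mu(M)$.
   Context: A matroid $M$ of rank $r(M)$ is paving if every circuit of $M$ has size at least $r(M)$. A join of a matroid $M$ on ground set $E(M)$ is a set $J\subseteq E(M)$ with $|J\cap C|\le |C|/2$ for every circuit $C$ of $M$. $\mu(M)$ is the maximum size of a join. Ear decompositions: for a nonempty sequence of circuits $C_1,\dots,C_t$ of $M$ put $D_0=\varnothing$ and $D_i=C_1\cup\dots\cup C_i$. The sequence is an ear decomposition of $M$ if $D_t=E(M)$ and for every $i\ge 2$: (E1) $C_i\cap D_{i-1}\neq\varnothing$; (E2) $C_i\setminus D_{i-1}\ne\varnothing$; (E3) no circuit $C$ of $M$ with $C\cap D_{i-1}\neq\varnothing$ and $C\setminus D_{i-1}\neq\varnothing$ has $C\setminus D_{i-1}$ properly contained in $C_i\setminus D_{i-1}$. The set $P_i=C_i\setminus D_{i-1}$ is the $i$th lobe; it is odd or even according to the parity of $|P_i|$. $\varphi(M)$ is the minimum number of even lobes over all ear decompositions of $M$. For a connected matroid $M$ not isomorphic to $U_{1,1}$ (the one-element rank-$1$ uniform matroid), an ear decomposition exists, and $\eta(M):=\frac{r(M)+\varphi(M)}{2}$, where $r(M)$ is the rank. *)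

(* Defs.v *)
From HB Require Import structures.
From mathcomp Require Import all_boot all_order all_algebra.
From mathcomp Require Import boolp.

Set Implicit Arguments.
Unset Strict Implicit.
Unset Printing Implicit Defensive.

Import Order.TTheory GRing.Theory Num.Theory.

(* The ground set is the whole finite type T. *)
Record matroid (T : finType) := Matroid {
  indep : {set {set T}};
  indep_set0 : set0 \in indep;
  indep_sub : forall A B : {set T},
    A \subset B -> B \in indep -> A \in indep;
  indep_aug : forall A B : {set T},
    A \in indep -> B \in indep -> #|A| < #|B| ->
    exists2 x, x \in B :\: A & x |: A \in indep
}.

Section Matroids.
Variables (T : finType) (M : matroid T).
Implicit Types (A C D J : {set T}) (Cs : seq {set T}).

Definition rank : nat := \max_(A in indep M) #|A|.

Definition circuit C : bool := minset [pred A : {set T} | A \notin indep M] C.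

Definition connected : Prop :=
  forall x y : T, x != y -> exists C, [/\ circuit C, x \in C & y \in C].

Definition paving : Prop := forall C, circuit C -> rank <= #|C|.

Definition join J : bool :=
  [forall C, circuit C ==> (2 * #|J :&: C| <= #|C|)].

Definition mu : nat := \max_(J | join J) #|J|.

(* Circuits are indexed from 0: C_(i+1) is [nth set0 Cs i], so that
   [ear_union Cs i] is D_i and [lobe Cs i] is P_(i+1). *)
Definition ear_union Cs (i : nat) : {set T} := \bigcup_(C <- take i Cs) C.

Definition lobe Cs (i : nat) : {set T} := nth set0 Cs i :\: ear_union Cs i.

Definition ear_step D C : Prop :=
  [/\ C :&: D != set0,
      C :\: D != set0
    & forall C', circuit C' -> C' :&: D != set0 -> C' :\: D != set0 ->
        ~~ (C' :\: D \proper C :\: D)].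

Definition ear_decomposition Cs : Prop :=
  [/\ Cs <> [::],
      {in Cs, forall C, circuit C},
      ear_union Cs (size Cs) = [set: T]
    & forall i, 0 < i < size Cs -> ear_step (ear_union Cs i) (nth set0 Cs i)].

Definition even_lobes Cs : nat :=
  \sum_(i < size Cs) ~~ odd #|lobe Cs i|.

Definition ear_number (k : nat) : Prop :=
  exists2 Cs, ear_decomposition Cs & even_lobes Cs = k.

Lemma ex_asbool_ear_number :
  (exists k, ear_number k) -> exists k, `[< ear_number k >].
Proof. by case=> k /asboolP; exists k. Qed.

(* The value 0 is a default for matroids without ear decomposition; by
   [phiP] and [connected_ear_decomposition] it is not used on the domain
   of [eta]. *)
Definition phi : nat :=
  if pselect (exists k, ear_number k) is left exk
  then ex_minn (ex_asbool_ear_number exk) else 0.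

Definition is_U11 : Prop := #|T| = 1 /\ rank = 1.

Definition eta : rat := ((rank + phi)%:R / 2%:R)%R.

Lemma phiP : (exists Cs, ear_decomposition Cs) ->
  ear_number phi /\
  (forall Cs, ear_decomposition Cs -> phi <= even_lobes Cs).
Proof.
case=> Cs0 ear0; rewrite /phi; case: pselect => [exk|[]]; last first.
  by exists (even_lobes Cs0), Cs0.
case: ex_minnP => k /asboolP kP kmin; split=> // Cs earCs.
by apply: kmin; apply/asboolP; exists Cs.
Qed.

Lemma ear_union_size Cs : ear_union Cs (size Cs) = \bigcup_(C <- Cs) C.
Proof. by rewrite /ear_union take_size. Qed.

Lemma ear_union_rcons Cs C i : i <= size Cs ->
  ear_union (rcons Cs C) i = ear_union Cs i.
Proof.
by move=> le_i; rewrite /ear_union -cats1 takel_cat.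
Qed.

Lemma ear_extend D : connected -> D != set0 -> D != setT ->
  exists2 C, circuit C & ear_step D C.
Proof.
move=> conM /set0Pn[x xD] DnT.
have /subsetPn[y _ yND] : ~~ ([set: T] \subset D) by rewrite subTset.
have xy : x != y by apply: contraNneq yND => <-.
have [C0 [cC0 xC0 yC0]] := conM x y xy.
pose P C := [&& circuit C, C :&: D != set0 & C :\: D != set0].
have PC0 : P C0.
  apply/and3P; split=> //; apply/set0Pn.
    by exists x; rewrite inE xC0.
  by exists y; rewrite inE yND.
case: (arg_minnP (fun C => #|C :\: D|) PC0) => C /and3P[cC CI CD] minC.
exists C => //; split=> // C' cC' C'I C'D; apply/negP => /proper_card.
by rewrite ltnNge minC // /P cC' C'I.
Qed.

Lemma connected_ear_decomposition :
  connected -> 0 < #|T| -> ~ is_U11 -> exists Cs, ear_decomposition Cs.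
Proof.
move=> conM T0 nU.
have [C0 cC0 C0n] : exists2 C, circuit C & C != set0.
  have [T1|T1] := ltnP 1 #|T|.
    have /card_gt1P[x [y [_ _ xy]]] := T1.
    have [C [cC xC _]] := conM x y xy.
    by exists C => //; apply/set0Pn; exists x.
  have {}T1 : #|T| = 1 by apply/eqP; rewrite eqn_leq T1.
  have TNI : [set: T] \notin indep M.
    apply/negP => TI; apply: nU; split=> //; apply/eqP.
    rewrite eqn_leq; apply/andP; split.
      by apply/bigmax_leqP => A _; rewrite -T1 max_card.
    by rewrite -T1 -cardsT /rank; exact: (@leq_bigmax_cond {set T} _ (fun A => #|A|)).
  have [C /minsetP[CN minC] _] :=
    minset_exists (P := [pred A : {set T} | A \notin indep M]) TNI.
  exists C; first exact/minsetP.
  by apply: contraNneq CN => ->; rewrite indep_set0.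
pose Q Cs := [/\ Cs <> [::], {in Cs, forall C, circuit C},
  ear_union Cs (size Cs) != set0
  & forall i, 0 < i < size Cs -> ear_step (ear_union Cs i) (nth set0 Cs i)].
suff H n Cs : Q Cs -> #|~: ear_union Cs (size Cs)| <= n ->
    exists Cs', ear_decomposition Cs'.
  apply: (H _ [:: C0]) (leqnn _); split=> //.
  - by move=> C; rewrite inE => /eqP->.
  - by rewrite ear_union_size big_seq1.
  - by case.
elim: n Cs => [|n IHn] Cs [Cs0 Cc Un step] le_n.
  exists Cs; split=> //; move: le_n; rewrite leqn0 cards_eq0 => /eqP U0.
  by rewrite -[LHS]setCK U0 setC0.
have [UT|UnT] := eqVneq (ear_union Cs (size Cs)) setT; first by exists Cs.
have [C cC stepC] := ear_extend conM Un UnT.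
have UE : ear_union (rcons Cs C) (size (rcons Cs C))
          = ear_union Cs (size Cs) :|: C.
  by rewrite !ear_union_size -cats1 big_cat big_seq1.
apply: (IHn (rcons Cs C)).
  split.
  - by case: (Cs).
  - by move=> C'; rewrite mem_rcons inE => /predU1P[->|/Cc].
  - by rewrite UE; apply: contraNneq Un => /eqP; rewrite setU_eq0 => /andP[].
  - move=> i; rewrite size_rcons ltnS => /andP[i0 ile].
    rewrite ear_union_rcons // nth_rcons.
    case: ltnP => [ilt|ige]; first by apply: step; rewrite i0.
    have -> : i = size Cs by apply/eqP; rewrite eqn_leq ile.
    by rewrite eqxx.
rewrite -ltnS; apply: leq_trans le_n; apply: proper_card.
have [_ /set0Pn[z]] := stepC; rewrite inE => /andP[zU zC] _.
rewrite UE; apply/properP; split; first by rewrite setCS subsetUl.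
by exists z; rewrite !inE ?zU // zC orbT.
Qed.

End Matroids.

(* Main.v *)
Require Import Defs.
From mathcomp Require Import all_boot all_order all_algebra.
From mathcomp Require Import zify.

(** The witness is the dual of the non-Fano matroid: rank 4 on the seven points
    of the Fano plane, the four-element circuits being the complements, or
    colines, of all the lines but one, [line0]. It is a sparse paving matroid, because two
    lines of the Fano plane meet in one point, so that their complements meet
    in two points only ([colines_meet]).

    As the complement [coline0] of [line0] is independent, adding to it a point
    of [line0] gives a circuit of size five ([circuit_setU1_coline0]). An ear
    decomposition can start with this circuit, and its two other lobes are then
    the two remaining points of [line0], one at a time. All lobes are odd, so
    phi = 0 and eta = 4 / 2 = 2.

    On the other hand [line0] is a join ([join_line0]): the complement of
    another line meets it in two points, and no five-element circuit
    contains it. A join cannot have four elements ([join_card]): it would meet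
    some circuit of size four or five in three points. *)

Set Implicit Arguments.
Unset Strict Implicit.
Unset Printing Implicit Defensive.

(** * Sparse paving matroids *)

Section SparsePaving.
Variables (T : finType) (r : nat) (H : {set {set T}}).
Implicit Types A B C : {set T}.

Definition sparse_indep : {set {set T}} :=
  [set A : {set T} | (#|A| <= r) && (A \notin H)].

Hypothesis r_gt0 : 0 < r.
Hypothesis cardH : forall A, A \in H -> #|A| = r.
Hypothesis meetH : forall A B, A \in H -> B \in H -> A != B ->
  #|A :&: B|.+1 < r.

Lemma sparse_indep_set0 : set0 \in sparse_indep.
Proof.
rewrite inE cards0 /=; apply/negP => /cardH.
by rewrite cards0 => r0; move: r_gt0; rewrite -r0.
Qed.

Lemma sparse_indep_sub A B :
  A \subset B -> B \in sparse_indep -> A \in sparse_indep.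
Proof.
move=> AB; rewrite !inE => /andP[Br BH].
rewrite (leq_trans (subset_leq_card AB) Br) /=.
apply: contra BH => AH; suff <- : A = B by [].
by apply/eqP; rewrite eqEcard AB (cardH AH).
Qed.

(** A set A of size r - 1 extends to at most one member of H, since two such
    members would share A; hence if B has two elements outside A, one of them
    works, and otherwise A + x = B. *)
Lemma sparse_indep_aug A B :
  A \in sparse_indep -> B \in sparse_indep -> #|A| < #|B| ->
  exists2 x, x \in B :\: A & x |: A \in sparse_indep.
Proof.
rewrite !inE => /andP[_ AH] /andP[Br BH] AB.
have /subsetPn[x xB xA] : ~~ (B \subset A).
  by apply: contraL AB => /subset_leq_card; rewrite -leqNgt.
have cardU z : z \notin A -> #|z |: A| = #|A|.+1 by move=> zA; rewrite cardsU1 zA.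
have Ar : #|A|.+1 <= r by apply: leq_trans Br.
have [xAH|xAH] := boolP (x |: A \in H); last first.
  by exists x; rewrite !inE ?xA // cardU // Ar.
have [/subsetP sBxA|/subsetPn[y yB]] := boolP (B \subset x |: A).
  suff xAB : B = x |: A by rewrite xAB xAH in BH.
  by apply/eqP; rewrite eqEcard cardU // AB andbT; apply/subsetP.
rewrite !inE negb_or => /andP[yx yA].
exists y; rewrite !inE ?yA // cardU // Ar /=.
apply/negP => yAH.
have neqU : x |: A != y |: A.
  apply: contraNneq yx => eqU; have : y \in x |: A by rewrite eqU setU11.
  by rewrite !inE (negPf yA) orbF.
have := meetH xAH yAH neqU.
have -> : (x |: A) :&: (y |: A) = A.
  apply/setP => z; rewrite !inE; case: (z \in A); rewrite ?orbT ?orbF //.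
  by apply/negP => /andP[/eqP-> /eqP xy]; rewrite xy eqxx in yx.
by rewrite -(cardH xAH) cardU // ltnn.
Qed.

Definition sparse_paving : matroid T :=
  Matroid sparse_indep_set0 sparse_indep_sub sparse_indep_aug.

Lemma sparse_paving_rank_le : rank sparse_paving <= r.
Proof. by apply/bigmax_leqP => A; rewrite inE => /andP[]. Qed.

Lemma sparse_paving_rank B : #|B| = r -> B \notin H -> rank sparse_paving = r.
Proof.
move=> Br BH; apply/eqP; rewrite eqn_leq sparse_paving_rank_le /=.
rewrite -[X in X <= _]Br; apply: (@leq_bigmax_cond {set T} _ (fun A => #|A|)).
by rewrite inE Br leqnn.
Qed.

(** A dependent set is a member of H or has more than r elements. The members
    of H, having the same size, are all minimal; a larger set is minimal when
    removing any element leaves only r elements and it contains no member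
    of H. *)
Lemma sparse_paving_circuit C :
  circuit sparse_paving C =
  (C \in H) || (#|C| == r.+1) && [forall A in H, ~~ (A \subset C)].
Proof.
have depE A : (A \notin indep sparse_paving) = (r < #|A|) || (A \in H).
  by rewrite inE negb_and -ltnNge negbK.
apply/minsetP/idP => /= [[]|].
  rewrite depE => /orP[Cr|-> //] minC.
  have Cr1 : #|C| == r.+1.
    rewrite eqn_leq Cr andbT leqNgt; apply/negP => Cr2.
    have /card_gt0P[x xC] : 0 < #|C| by apply: leq_trans Cr.
    have Cx : #|C :\ x|.+1 = #|C| by rewrite [RHS](cardsD1 x) xC.
    have /setP/(_ x) : C :\ x = C.
      by apply: minC; rewrite ?subD1set // depE -ltnS Cx Cr2.
    by rewrite !inE eqxx xC.
  rewrite Cr1; apply/orP; right; apply/forall_inP => A AH; apply/negP => sAC.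
  have AEC : A = C by apply: minC => //; rewrite depE AH orbT.
  by move: Cr; rewrite -AEC (cardH AH) ltnn.
rewrite depE => /orP[CH|/andP[/eqP Cr /forall_inP CH]].
  split=> [|A]; first by rewrite CH orbT.
  rewrite depE => /orP[Ar|AH] sAC; last first.
    by apply/eqP; rewrite eqEcard sAC (cardH AH) (cardH CH) leqnn.
  by have := leq_trans Ar (subset_leq_card sAC); rewrite (cardH CH) ltnn.
split=> [|A]; first by rewrite Cr ltnSn.
rewrite depE => /orP[Ar|AH] sAC; last by have := CH A AH; rewrite sAC.
by apply/eqP; rewrite eqEcard sAC Cr.
Qed.

Lemma sparse_paving_paving : paving sparse_paving.
Proof.
move=> C; rewrite sparse_paving_circuit => CC.
apply: (leq_trans sparse_paving_rank_le).
by case/orP: CC => [/cardH->|/andP[/eqP->]].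
Qed.

End SparsePaving.

(** * Complements of Fano lines *)

Lemma card_set_ord n (P : pred nat) :
  #|[set i : 'I_n | P i]| = count P (iota 0 n).
Proof.
by rewrite cardsE cardE /enum_mem size_filter -enumT -val_enum_ord count_map.
Qed.

(** The lines are the translates of the difference set {1, 2, 4} mod 7, so
    that their complements are the translates of {0, 3, 5, 6}; adding 7 before
    the truncated subtraction gives the difference mod 7. *)
Definition in_coline (k i : nat) : bool := (i + 7 - k) %% 7 \in [:: 0; 3; 5; 6].

Definition coline (k : 'I_7) : {set 'I_7} := [set i : 'I_7 | in_coline k i].

Lemma card_coline k : #|coline k| = 4.
Proof. by rewrite card_set_ord; case: k; do 7!case=> //. Qed.

(** Two lines of the Fano plane cover 3 + 3 - 1 of the seven points. *)
Lemma card_coline_meet k l : k != l -> #|coline k :&: coline l| = 2.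
Proof.
move=> kl.
have -> : coline k :&: coline l
        = [set i : 'I_7 | in_coline k i && in_coline l i].
  by apply/setP => i; rewrite !inE.
rewrite (card_set_ord 7 (fun i => in_coline k i && in_coline l i)).
have /allP/(_ k) : all (fun k => all (fun l => (k != l) ==>
    (count (fun i => in_coline k i && in_coline l i) (iota 0 7) == 2))
    (iota 0 7)) (iota 0 7) by vm_compute.
rewrite mem_iota ltn_ord => /(_ isT)/allP/(_ l).
by rewrite mem_iota ltn_ord => /(_ isT)/implyP/(_ kl)/eqP.
Qed.

(** Two distinct points of the Fano plane are avoided by 7 - 3 - 3 + 1 = 2 of
    its lines, and a single point by 7 - 3 = 4: at least one of these lines is
    not the line 0. *)
Lemma coline_cover (x y : 'I_7) :
  exists k, [/\ k != ord0, x \in coline k & y \in coline k].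
Proof.
have /allP/(_ x) : all (fun x => all (fun y =>
    has (fun k => in_coline k x && in_coline k y) (iota 1 6))
    (iota 0 7)) (iota 0 7) by vm_compute.
rewrite mem_iota ltn_ord => /(_ isT)/allP/(_ y).
rewrite mem_iota ltn_ord => /(_ isT)/hasP[k].
rewrite mem_iota => /andP[k_gt0 k_lt7] /andP[xk yk].
by exists (Ordinal k_lt7); rewrite !inE xk yk -lt0n.
Qed.

Definition colines : {set {set 'I_7}} := [set coline k | k in [set~ ord0]].

Lemma mem_colines k : k != ord0 -> coline k \in colines.
Proof. by move=> k0; apply: imset_f; rewrite !inE. Qed.

Lemma card_colines A : A \in colines -> #|A| = 4.
Proof. by case/imsetP=> k _ ->; apply: card_coline. Qed.

Lemma colines_meet A B : A \in colines -> B \in colines -> A != B ->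
  #|A :&: B|.+1 < 4.
Proof.
case/imsetP=> k _ -> /imsetP[l _ ->] kl.
by rewrite card_coline_meet //; apply: contraNneq kl => ->.
Qed.

Notation coline0 := (coline ord0).
Notation line0 := (~: coline0).

Lemma card_line0 : #|line0| = 3.
Proof. by have := cardsC coline0; rewrite card_coline card_ord => -[]. Qed.

Lemma card_coline_coline0 k : k != ord0 -> #|coline k :&: coline0| = 2.
Proof. exact: card_coline_meet. Qed.

Lemma card_coline_line0 k : k != ord0 -> #|coline k :&: line0| = 2.
Proof.
move=> k0; rewrite -setDE; have := cardsID coline0 (coline k).
by rewrite card_coline_coline0 // card_coline => -[].
Qed.

Lemma coline0_notin_colines : coline0 \notin colines.
Proof.
apply/imsetP => -[k]; rewrite !inE => k0 Ok.
by have := card_coline_coline0 k0; rewrite -Ok setIid card_coline.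
Qed.

(** * The dual of the non-Fano matroid *)

Definition dual_nonfano : matroid 'I_7 :=
  sparse_paving (isT : 0 < 4) card_colines colines_meet.

Lemma circuit_coline k : k != ord0 -> circuit dual_nonfano (coline k).
Proof. by move=> k0; rewrite sparse_paving_circuit mem_colines. Qed.

(** The complement of another line contains two points of [line0], whereas
    this set contains only one: no smaller circuit fits in it. *)
Lemma circuit_setU1_coline0 j : j \in line0 -> circuit dual_nonfano (j |: coline0).
Proof.
rewrite inE => jO; rewrite sparse_paving_circuit cardsU1 jO card_coline /=.
apply/orP; right; apply/forall_inP => _ /imsetP[k k0 ->].
rewrite !inE in k0; apply/negP => /(setSI line0) /subset_leq_card.
rewrite card_coline_line0 // setIUl setICr setU0 => le2j.
by have := leq_trans le2j (subset_leq_card (subsetIl _ _)); rewrite cards1.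
Qed.

Lemma dual_nonfano_connected : connected dual_nonfano.
Proof.
move=> x y _; have [k [k0 xk yk]] := coline_cover x y.
by exists (coline k); split=> //; apply: circuit_coline.
Qed.

Lemma dual_nonfano_rank : rank dual_nonfano = 4.
Proof. exact: sparse_paving_rank (card_coline _) coline0_notin_colines. Qed.

(** * Joins *)

(** A five-element set containing [line0] has just two points on [coline0].
    Some coline other than [coline0] contains these two points; its other two
    points are on [line0], so that it is a circuit properly contained in the
    given set, which is then not a circuit. *)
Lemma join_line0 : join dual_nonfano line0.
Proof.
apply/forallP => C; apply/implyP; rewrite sparse_paving_circuit.
case/orP=> [/imsetP[k]|/andP[/eqP C5 /forall_inP CH]].
  by rewrite !inE => k0 ->; rewrite setIC card_coline_line0 // card_coline.
have : ~~ (line0 \subset C).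
  apply/negP => line0C.
  have CO2 : #|C :&: coline0| = 2.
    have := cardsID coline0 C; rewrite C5 setDE.
    by rewrite (setIidPr line0C) card_line0 addn3 => -[].
  have /cards2P[x [y [_ COE]]] : #|C :&: coline0| == 2 by rewrite CO2.
  have [k [k0 xk yk]] := coline_cover x y.
  have /setIP[_ xO] : x \in C :&: coline0 by rewrite COE set21.
  have /setIP[_ yO] : y \in C :&: coline0 by rewrite COE set22.
  have kCO : C :&: coline0 = coline k :&: coline0.
    apply/eqP; rewrite eqEcard CO2 card_coline_coline0 // andbT COE.
    by apply/subsetP => z /set2P[]->; apply/setIP.
  have /negP := CH _ (mem_colines k0); apply; apply/subsetP => z zk.
  have [zO|zO] := boolP (z \in coline0).
    by have /setIP[] : z \in C :&: coline0 by rewrite kCO inE zk.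
  by apply: (subsetP line0C); rewrite inE.
by move=> /properIl/proper_card; rewrite card_line0 C5; lia.
Qed.

Lemma joinP J C : join dual_nonfano J -> circuit dual_nonfano C ->
  2 * #|J :&: C| <= #|C|.
Proof. by move/forallP/(_ C)/implyP. Qed.

(** If J contains [line0] and a point x off it, then a coline through x other
    than [coline0] has x and its two points of [line0] in J. If not, J has at
    most two points on [line0], and at most two on [coline0] because of the
    circuit j + [coline0] for any j on [line0]; were J to have four elements,
    it would contain such a j together with two points of [coline0], three
    points of that circuit. *)
Lemma join_card J : join dual_nonfano J -> #|J| <= 3.
Proof.
move=> joinJ; rewrite leqNgt; apply/negP => J4.
have splitJ := cardsID coline0 J; rewrite setDE in splitJ.
have [line0J|] := boolP (line0 \subset J).
  rewrite (setIidPr line0J) card_line0 in splitJ.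
  have /card_gt0P[x /setIP[xJ xO]] : 0 < #|J :&: coline0|.
    by rewrite -(ltn_add2r 3) splitJ.
  have [k [k0 xk _]] := coline_cover x x.
  have := joinP joinJ (circuit_coline k0).
  rewrite card_coline (leq_mul2l 2 _ 2) /= leqNgt => /negP; apply.
  have cardU : #|x |: (coline k :&: line0)| = 3.
    by rewrite cardsU1 card_coline_line0 // in_setI in_setC xO andbF.
  rewrite -[X in X <= _]cardU; apply: subset_leq_card.
  rewrite subUset sub1set inE xJ xk /=.
  by rewrite subsetI subsetIl (subset_trans (subsetIr _ _)).
move=> /properIl/proper_card; rewrite setIC card_line0 => Jline0.
have Jcoline0 j : j \in line0 -> #|J :&: coline0| + (j \in J) <= 2.
  move=> jO; have := joinP joinJ (circuit_setU1_coline0 jO).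
  rewrite inE in jO; rewrite cardsU1 jO card_coline.
  by rewrite (cardsD1 j) -setIDA setU1K // in_setI setU11 andbT; lia.
have /card_gt0P[j /setIP[jJ jO]] : 0 < #|J :&: line0|.
  have /card_gt0P[j jO] : 0 < #|line0| by rewrite card_line0.
  have := Jcoline0 j jO; move: J4; rewrite -splitJ; lia.
have := Jcoline0 j jO; move: J4; rewrite -splitJ jJ; lia.
Qed.

Lemma mu_dual_nonfano : mu dual_nonfano = 3.
Proof.
apply/eqP; rewrite eqn_leq; apply/andP; split.
  by apply/bigmax_leqP => J; apply: join_card.
rewrite -[X in X <= _]card_line0.
exact: (@leq_bigmax_cond {set 'I_7} _ (fun A => #|A|)) join_line0.
Qed.

(** * An ear decomposition without even lobes *)

(** Condition (E3) is automatic for a lobe of size one. *)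
Lemma ear_step_singleton (T : finType) (M : matroid T) (D C : {set T}) x :
  C :&: D != set0 -> C :\: D = [set x] -> ear_step M D C.
Proof.
move=> CD Cx; rewrite /ear_step Cx; split=> //.
  by apply/set0Pn; exists x; rewrite set11.
move=> C' _ _ C'0; apply/negP.
by rewrite properEcard cards1 ltnS leqn0 cards_eq0 (negPf C'0) andbF.
Qed.

(** Once an ear union contains [coline0] and a point a of [line0], each further
    point b can be added alone: a coline through a and b has no other point on
    [line0]. *)
Lemma coline_lobe (a b : 'I_7) (D : {set 'I_7}) :
  a \in line0 -> coline0 \subset D -> a \in D -> b \notin D ->
  exists C, [/\ circuit dual_nonfano C, ear_step dual_nonfano D C & C :\: D = [set b]].
Proof.
move=> aO OD aD bD; have [k [k0 ak bk]] := coline_cover a b.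
suff kD : coline k :\: D = [set b].
  exists (coline k); split=> //; first exact: circuit_coline.
  by apply: ear_step_singleton kD; apply/set0Pn; exists a; rewrite inE ak.
have kline0 : [set a; b] = coline k :&: line0.
  apply/eqP; rewrite eqEcard card_coline_line0 // cards2.
  have -> : a != b by apply: contraNneq bD => <-.
  rewrite andbT; apply/subsetP => z /set2P[]->; apply/setIP; split=> //.
  by rewrite inE; apply: contra bD; apply: (subsetP OD).
apply/setP => z; rewrite inE in_set1; apply/andP/eqP => [[zD zk]|-> //].
have : z \in coline k :&: line0.
  by rewrite !(inE, zk) /=; apply: contra zD => zO; apply: (subsetP OD); rewrite inE.
by rewrite -kline0 => /set2P[za|//]; rewrite za aD in zD.
Qed.

Lemma setU_setD_singleton (T : finType) (C D : {set T}) x :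
  C :\: D = [set x] -> D :|: C = x |: D.
Proof.
by move=> CD; rewrite -{1}(setID C D) CD setUA (setUidPl (subsetIr C D)) setUC.
Qed.

Lemma ear_number_dual_nonfano : ear_number dual_nonfano 0.
Proof.
have /card_gt2P[a [b [c [[aJ bJ cJ] [ab bc ca]]]]] : 2 < #|line0| by rewrite card_line0.
rewrite inE in bJ; rewrite inE in cJ.
set D1 := a |: coline0; set D2 := b |: D1; set D3 := c |: D2.
have bD1 : b \notin D1 by rewrite in_setU1 negb_or eq_sym ab.
have cD2 : c \notin D2 by rewrite !in_setU1 !negb_or ca eq_sym bc.
have D3T : D3 = setT.
  apply/eqP; rewrite eqEcard subsetT cardsT card_ord.
  rewrite in_setC in aJ.
  by rewrite 3!cardsU1 cD2 bD1 aJ card_coline.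
have OD1 : coline0 \subset D1 := subsetUr _ _.
have OD2 : coline0 \subset D2 := subset_trans OD1 (subsetUr _ _).
have aD1 : a \in D1 := setU11 _ _.
have aD2 : a \in D2 := setU1r _ aD1.
have [C2 [cC2 sC2 lC2]] := coline_lobe aJ OD1 aD1 bD1.
have [C3 [cC3 sC3 lC3]] := coline_lobe aJ OD2 aD2 cD2.
pose Cs := [:: D1; C2; C3].
have U1 : ear_union Cs 1 = D1 by rewrite /ear_union /= big_seq1.
have U2 : ear_union Cs 2 = D2.
  by rewrite /ear_union /= !big_cons big_nil setU0 (setU_setD_singleton lC2).
have U3 : ear_union Cs 3 = setT.
  rewrite /ear_union /= !big_cons big_nil setU0 setUA.
  by rewrite (setU_setD_singleton lC2) (setU_setD_singleton lC3).
exists Cs.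
  split=> //.
  - move=> C; rewrite !inE => /or3P[]/eqP-> //; exact: circuit_setU1_coline0.
  - case=> [|[|[|i]]] //= _; by rewrite ?U1 ?U2.
rewrite /even_lobes !big_ord_recl big_ord0 /lobe /= U1 U2 lC2 lC3 !cards1.
by rewrite /ear_union take0 big_nil setD0 cardsU1 card_coline -in_setC aJ.
Qed.

Lemma eta_dual_nonfano : eta dual_nonfano = 2%:R%R.
Proof.
have [Cs ear Cs0] := ear_number_dual_nonfano.
have [_ /(_ Cs ear)] := phiP (ex_intro _ Cs ear).
by rewrite Cs0 leqn0 /eta dual_nonfano_rank => /eqP->.
Qed.

Theorem proposition3p3 :
  exists (T : finType) (M : matroid T),
    [/\ connected M, paving M, mu M = 3, eta M = 2%:R%R
      & (eta M < (mu M)%:R)%R].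
Proof.
exists 'I_7, dual_nonfano; rewrite mu_dual_nonfano eta_dual_nonfano.
split=> //; first exact: dual_nonfano_connected.
exact: sparse_paving_paving.
Qed.
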